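(* Let $\mathcal{L}$ be either a logic $\mathsf{M}\mathcal{A}$ with $\mathcal{A}\subseteq\{\mathsf N,\mathsf C,\mathsf P,\mathsf D,\mathsf 4\}$, or one of $\mathsf{M5},\mathsf{MP5},\mathsf{M45},\mathsf{MP45},\mathsf{MD45},\mathsf{K45},\mathsf{KD45}$. Then every derivation in the sequent calculus $\mathsf{G}_{\mathcal{L}}$ extended with contraction, weakening and the multicut rule can be converted into a derivation in $\mathsf{G}_{\mathcal{L}}$ extended with contraction and weakening (without multicut) with the same endsequent.
   Context: Formulas: propositional variables, $\bot,\top,\neg,\land,\lor,\to,\Box$; sequents $\Gamma\Rightarrow\Delta$ are pairs of finite multisets; $\Box\Gamma=\{\Box B:B\in\Gamma\}$, $A^n$ is $n$ copies of $A$. Logics: for a set $\mathcal{A}$ of axiom names, $\mathsf{M}\mathcal{A}$ is the smallest set containing propositional tautologies, $\Box(A\land B)\to(\Box A\land\Box B)$ and the axioms in $\mathcal{A}$ ($\mathsf C: (\Box A\land\Box B)\to\Box(A\land B)$, $\mathsf N: \Box\top$, $\mathsf P: \neg\Box\bot$, $\mathsf D: \neg(\Box A\land\Box\neg A)$, $\mathsf 4: \Box A\to\Box\Box A$, $\mathsf 5: \Box A\lor\Box\neg\Box A$), closed under modus ponens and from $A\to B$, $B\to A$ infer $\Box A\to\Box B$. $\mathsf{M5}=\mathsf M\{\mathsf5\}$, $\mathsf{MP5}=\mathsf M\{\mathsf P,\mathsf5\}$, $\mathsf{M45}=\mathsf M\{\mathsf4,\mathsf5\}$, $\mathsf{MP45}=\mathsf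 M\{\mathsf P,\mathsf4,\mathsf5\}$, $\mathsf{MD45}=\mathsf M\{\mathsf D,\mathsf4,\mathsf5\}$, $\mathsf{K45}=\mathsf M\{\mathsf C,\mathsf N,\mathsf4,\mathsf5\}$, $\mathsf{KD45}=\mathsf M\{\mathsf C,\mathsf N,\mathsf D,\mathsf4,\mathsf5\}$. Propositional calculus $\mathsf G$: initial sequents $\Gamma,p\Rightarrow p,\Delta$ ($p$ atomic), $\Gamma,\bot\Rightarrow\Delta$, $\Gamma\Rightarrow\top,\Delta$, and the standard two-sided invertible rules for $\neg,\land,\lor,\to$ with contexts. Modal sequent rules (no extra context in conclusions unless shown): $\mathsf M$: $A\Rightarrow B$ / $\Box A\Rightarrow\Box B$; $\mathsf N$: $\Rightarrow A$ / $\Rightarrow\Box A$; $\mathsf P$: $A\Rightarrow$ / $\Box A\Rightarrow$; $\mathsf D$: $A,B\Rightarrow$ / $\Box A,\Box B\Rightarrow$; $\mathsf T$: $\Gamma,A\Rightarrow\Delta$ / $\Gamma,\Box A\Rightarrow\Delta$; $\mathsf 4$: $\Box A\Rightarrow B$ / $\Box A\Rightarrow\Box B$; $\mathsf 5$: $\Rightarrow A,\Box B$ / $\Rightarrow\Box A,\Box B$; $\mathsf{D4}$: $A,\Box B\Rightarrow$ / $\Box A,\Box B\Rightarrow$; $\mathsf{D5}$: $A\Rightarrow\Box B$ / $\Box A\Rightarrow\Box B$; $\mathsf C$: $\Gamma\Rightarrow A$ / $\Box\Gamma\Rightarrow\Box A$ ($|\Gamma|\geq1$); $\mathsf{CD}$: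 $\Gamma\Rightarrow$ / $\Box\Gamma\Rightarrow$; $\mathsf{C4}$: $\Box\Gamma,\Sigma\Rightarrow B$ / $\Box\Gamma,\Box\Sigma\Rightarrow\Box B$ ($|\Gamma,\Sigma|\geq1$); $\mathsf{CD4}$: $\Box\Gamma,\Sigma\Rightarrow$ / $\Box\Gamma,\Box\Sigma\Rightarrow$; $\mathsf{K4}$: $\Box\Gamma,\Sigma\Rightarrow A$ / $\Box\Gamma,\Box\Sigma\Rightarrow\Box A$; $\mathsf{K45}$: $\Box\Gamma,\Sigma\Rightarrow A,\Box\Delta$ / $\Box\Gamma,\Box\Sigma\Rightarrow\Box A,\Box\Delta$; $\mathsf{KD45}$: $\Box\Gamma,\Sigma\Rightarrow\Box\Delta$ / $\Box\Gamma,\Box\Sigma\Rightarrow\Box\Delta$. Calculi: for $\mathcal{A}\subseteq\{\mathsf N,\mathsf P,\mathsf D,\mathsf T,\mathsf 4,\mathsf 5\}$, $\mathsf G_{\mathsf M\mathcal A}$ is $\mathsf G$ plus the rules $\{\mathsf M\}\cup\mathcal A$, plus $\mathsf{D4}$ if $\{\mathsf D,\mathsf4\}\subseteq\mathcal A$, plus $\mathsf{D5}$ if $\{\mathsf D,\mathsf5\}\subseteq\mathcal A$. The calculus for $\mathsf M(\{\mathsf C\}\cup\mathcal A)$ is $\mathsf G$ plus the rules $\{\mathsf C\}\cup\mathcal A$, plus $\mathsf{CD}$ if $\mathsf P\in\mathcal A$ or $\mathsf D\in\mathcal A$; $\mathsf{C4}$ if $\mathsf 4\in\mathcal A$; $\mathsf{CD4}$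 if $\{\mathsf P,\mathsf4\}\subseteq\mathcal A$ or $\{\mathsf D,\mathsf4\}\subseteq\mathcal A$; $\mathsf{K4}$ if $\{\mathsf N,\mathsf4\}\subseteq\mathcal A$; $\mathsf{K45}$ if $\{\mathsf N,\mathsf4,\mathsf5\}\subseteq\mathcal A$; $\mathsf{KD45}$ if $\{\mathsf N,\mathsf P,\mathsf4,\mathsf5\}\subseteq\mathcal A$ or $\{\mathsf N,\mathsf D,\mathsf4,\mathsf5\}\subseteq\mathcal A$. Contraction and weakening are the usual left/right structural rules. Multicut: from $\Gamma\Rightarrow\Delta,A^n$ and $A^m,\Sigma\Rightarrow\Pi$ ($n,m\geq1$) infer $\Gamma,\Sigma\Rightarrow\Delta,\Pi$. *)

(* Defs.v *)
From HB Require Import structures.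
From mathcomp Require Import all_boot.
From mathcomp Require Export finmap multiset.

Set Implicit Arguments.
Unset Strict Implicit.
Unset Printing Implicit Defensive.

Local Open Scope mset_scope.

Inductive form : Type :=
| Var of nat
| Bot
| Top
| Neg of form
| And of form & form
| Or of form & form
| Imp of form & form
| Box of form.

(* {mset form} needs a choiceType on form, obtained by encoding in trees. *)
Fixpoint form_to_tree (A : form) : GenTree.tree nat :=
  match A with
  | Var p => GenTree.Leaf p
  | Bot => GenTree.Node 0 [::]
  | Top => GenTree.Node 1 [::]
  | Neg B => GenTree.Node 2 [:: form_to_tree B]
  | And B C => GenTree.Node 3 [:: form_to_tree B; form_to_tree C]
  | Or B C => GenTree.Node 4 [:: form_to_tree B; form_to_tree C]
  | Imp B C => GenTree.Node 5 [:: form_to_tree B; form_to_tree C]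
  | Box B => GenTree.Node 6 [:: form_to_tree B]
  end.

Fixpoint form_of_tree (t : GenTree.tree nat) : form :=
  match t with
  | GenTree.Leaf p => Var p
  | GenTree.Node 1 [::] => Top
  | GenTree.Node 2 [:: t1] => Neg (form_of_tree t1)
  | GenTree.Node 3 [:: t1; t2] => And (form_of_tree t1) (form_of_tree t2)
  | GenTree.Node 4 [:: t1; t2] => Or (form_of_tree t1) (form_of_tree t2)
  | GenTree.Node 5 [:: t1; t2] => Imp (form_of_tree t1) (form_of_tree t2)
  | GenTree.Node 6 [:: t1] => Box (form_of_tree t1)
  | _ => Bot
  end.

Lemma form_to_treeK : cancel form_to_tree form_of_tree.
Proof. by elim=> //= [A ->|A -> B ->|A -> B ->|A -> B ->|A ->]. Qed.

HB.instance Definition _ := Countable.copy form (can_type form_to_treeK).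

Definition sequent : Type := ({mset form} * {mset form})%type.

Notation "Gamma ⇒ Delta" := ((Gamma, Delta) : sequent)
  (at level 70, no associativity) : mset_scope.

(* Multiplicities are kept, since Box is injective. *)
Definition boxes (Gamma : {mset form}) : {mset form} :=
  seq_mset [seq Box B | B <- Gamma].

(* [R ps c]: the premises [ps] and the conclusion [c] form an instance of one
   of the rules in [R]. *)
Definition rules : Type := seq sequent -> sequent -> Prop.

Definition add_rules (R R' : rules) : rules := fun ps c => R ps c \/ R' ps c.

Inductive derivable (R : rules) : sequent -> Prop :=
| derivable_rule ps c :
    R ps c -> (forall p, p \in ps -> derivable R p) -> derivable R c.

Inductive G_rules : rules :=
| G_init p Gamma Delta :
    G_rules [::] (Var p +` Gamma ⇒ Var p +` Delta)
| G_botL Gamma Delta :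
    G_rules [::] (Bot +` Gamma ⇒ Delta)
| G_topR Gamma Delta :
    G_rules [::] (Gamma ⇒ Top +` Delta)
| G_negL A Gamma Delta :
    G_rules [:: Gamma ⇒ A +` Delta] (Neg A +` Gamma ⇒ Delta)
| G_negR A Gamma Delta :
    G_rules [:: A +` Gamma ⇒ Delta] (Gamma ⇒ Neg A +` Delta)
| G_andL A B Gamma Delta :
    G_rules [:: A +` (B +` Gamma) ⇒ Delta] (And A B +` Gamma ⇒ Delta)
| G_andR A B Gamma Delta :
    G_rules [:: Gamma ⇒ A +` Delta; Gamma ⇒ B +` Delta]
            (Gamma ⇒ And A B +` Delta)
| G_orL A B Gamma Delta :
    G_rules [:: A +` Gamma ⇒ Delta; B +` Gamma ⇒ Delta]
            (Or A B +` Gamma ⇒ Delta)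
| G_orR A B Gamma Delta :
    G_rules [:: Gamma ⇒ A +` (B +` Delta)] (Gamma ⇒ Or A B +` Delta)
| G_impL A B Gamma Delta :
    G_rules [:: Gamma ⇒ A +` Delta; B +` Gamma ⇒ Delta]
            (Imp A B +` Gamma ⇒ Delta)
| G_impR A B Gamma Delta :
    G_rules [:: A +` Gamma ⇒ B +` Delta] (Gamma ⇒ Imp A B +` Delta).

Inductive modal_name : Type :=
| rM | rN | rP | rD | rT | r4 | r5 | rD4 | rD5
| rC | rCD | rC4 | rCD4 | rK4 | rK45 | rKD45.

Inductive modal_rule : modal_name -> rules :=
| mM A B :
    modal_rule rM [:: [mset A] ⇒ [mset B]] ([mset Box A] ⇒ [mset Box B])
| mN A :
    modal_rule rN [:: mset0 ⇒ [mset A]] (mset0 ⇒ [mset Box A])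
| mP A :
    modal_rule rP [:: [mset A] ⇒ mset0] ([mset Box A] ⇒ mset0)
| mD A B :
    modal_rule rD [:: A +` [mset B] ⇒ mset0]
                  (Box A +` [mset Box B] ⇒ mset0)
| mT A Gamma Delta :
    modal_rule rT [:: A +` Gamma ⇒ Delta] (Box A +` Gamma ⇒ Delta)
| m4 A B :
    modal_rule r4 [:: [mset Box A] ⇒ [mset B]] ([mset Box A] ⇒ [mset Box B])
| m5 A B :
    modal_rule r5 [:: mset0 ⇒ A +` [mset Box B]]
                  (mset0 ⇒ Box A +` [mset Box B])
| mD4 A B :
    modal_rule rD4 [:: A +` [mset Box B] ⇒ mset0]
                   (Box A +` [mset Box B] ⇒ mset0)
| mD5 A B :
    modal_rule rD5 [:: [mset A] ⇒ [mset Box B]] ([mset Box A] ⇒ [mset Box B])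
| mC Gamma A :
    Gamma != mset0 ->
    modal_rule rC [:: Gamma ⇒ [mset A]] (boxes Gamma ⇒ [mset Box A])
| mCD Gamma :
    modal_rule rCD [:: Gamma ⇒ mset0] (boxes Gamma ⇒ mset0)
| mC4 Gamma Sigma B :
    Gamma `+` Sigma != mset0 ->
    modal_rule rC4 [:: boxes Gamma `+` Sigma ⇒ [mset B]]
                   (boxes Gamma `+` boxes Sigma ⇒ [mset Box B])
| mCD4 Gamma Sigma :
    modal_rule rCD4 [:: boxes Gamma `+` Sigma ⇒ mset0]
                    (boxes Gamma `+` boxes Sigma ⇒ mset0)
| mK4 Gamma Sigma A :
    modal_rule rK4 [:: boxes Gamma `+` Sigma ⇒ [mset A]]
                   (boxes Gamma `+` boxes Sigma ⇒ [mset Box A])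
| mK45 Gamma Sigma A Delta :
    modal_rule rK45 [:: boxes Gamma `+` Sigma ⇒ A +` boxes Delta]
                    (boxes Gamma `+` boxes Sigma ⇒ Box A +` boxes Delta)
| mKD45 Gamma Sigma Delta :
    modal_rule rKD45 [:: boxes Gamma `+` Sigma ⇒ boxes Delta]
                     (boxes Gamma `+` boxes Sigma ⇒ boxes Delta).

Inductive axiom_name : Type := axN | axC | axP | axD | axT | ax4 | ax5.

(* {set axiom_name} needs a finType on axiom_name. *)
Definition axiom_to_nat (a : axiom_name) : nat :=
  match a with
  | axN => 0 | axC => 1 | axP => 2 | axD => 3 | axT => 4 | ax4 => 5 | ax5 => 6
  end.

Definition axiom_of_nat (n : nat) : axiom_name :=
  nth axN [:: axN; axC; axP; axD; axT; ax4; ax5] n.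

Lemma axiom_to_natK : cancel axiom_to_nat axiom_of_nat.
Proof. by case. Qed.

HB.instance Definition _ := Countable.copy axiom_name (can_type axiom_to_natK).

Lemma axiom_enumP : Finite.axiom [:: axN; axC; axP; axD; axT; ax4; ax5].
Proof. by case. Qed.

HB.instance Definition _ := isFinite.Build axiom_name axiom_enumP.

(* The modal rules of the calculus for the logic axiomatised by [Ax]. *)
Definition has_modal_rule (Ax : {set axiom_name}) (r : modal_name) : bool :=
  let N := axN \in Ax in let P := axP \in Ax in let D := axD \in Ax in
  let F := ax4 \in Ax in let E := ax5 \in Ax in
  if axC \in Ax then
    match r with
    | rC => true
    | rN => N
    | rP => P
    | rD => D
    | rT => axT \in Ax
    | r4 => F
    | r5 => E
    | rCD => P || D
    | rC4 => F
    | rCD4 => P && F || D && F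
    | rK4 => N && F
    | rK45 => [&& N, F & E]
    | rKD45 => [&& N, P, F & E] || [&& N, D, F & E]
    | rM | rD4 | rD5 => false
    end
  else
    match r with
    | rM => true
    | rN => N
    | rP => P
    | rD => D
    | rT => axT \in Ax
    | r4 => F
    | r5 => E
    | rD4 => D && F
    | rD5 => D && E
    | rC | rCD | rC4 | rCD4 | rK4 | rK45 | rKD45 => false
    end.

Inductive modal_rules (Ax : {set axiom_name}) : rules :=
| modal_rules_of r ps c :
    has_modal_rule Ax r -> modal_rule r ps c -> modal_rules Ax ps c.

Definition calculus (Ax : {set axiom_name}) : rules :=
  add_rules G_rules (modal_rules Ax).

Inductive structural_rules : rules :=
| weakL A Gamma Delta :
    structural_rules [:: Gamma ⇒ Delta] (A +` Gamma ⇒ Delta)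
| weakR A Gamma Delta :
    structural_rules [:: Gamma ⇒ Delta] (Gamma ⇒ A +` Delta)
| contrL A Gamma Delta :
    structural_rules [:: A +` (A +` Gamma) ⇒ Delta] (A +` Gamma ⇒ Delta)
| contrR A Gamma Delta :
    structural_rules [:: Gamma ⇒ A +` (A +` Delta)] (Gamma ⇒ A +` Delta).

Inductive multicut_rule : rules :=
| multicut A n m Gamma Delta Sigma Pi :
    0 < n -> 0 < m ->
    multicut_rule
      [:: Gamma ⇒ Delta `+` msetn n A; msetn m A `+` Sigma ⇒ Pi]
      (Gamma `+` Sigma ⇒ Delta `+` Pi).

Definition calculus_CW (Ax : {set axiom_name}) : rules :=
  add_rules (calculus Ax) structural_rules.

Definition calculus_CW_cut (Ax : {set axiom_name}) : rules :=
  add_rules (calculus_CW Ax) multicut_rule.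

Definition ax_M5 : {set axiom_name} := [set ax5].
Definition ax_MP5 : {set axiom_name} := [set axP; ax5].
Definition ax_M45 : {set axiom_name} := [set ax4; ax5].
Definition ax_MP45 : {set axiom_name} := [set axP; ax4; ax5].
Definition ax_MD45 : {set axiom_name} := [set axD; ax4; ax5].
Definition ax_K45 : {set axiom_name} := [set axC; axN; ax4; ax5].
Definition ax_KD45 : {set axiom_name} := [set axC; axN; axD; ax4; ax5].

(* Main.v *)
(** Contraction and weakening let us read sequents up to inclusion of the
underlying sets, so it suffices to eliminate cuts in a calculus whose rules keep
their principal formula, where weakening and contraction preserve height.
Every modal rule other than [T] has the form

      X, Box Y => U, Box V   /   Box X, Box Y => Box U, Box V

and the logics differ only in the admitted sizes of [(X, Y, U, V)].  A cut on
[Box C] that is principal in two such steps is handled in two stages: the boxed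
copies of [C] are removed from each premise by cutting it against the conclusion
of the other step, which lowers the height, and then the premises are cut on
[C].  What remains to check is that the admitted sizes are closed under this
operation; that is where the choice of logics enters. *)

Require Import Defs.
From mathcomp Require Import all_boot zify.

Set Implicit Arguments.
Unset Strict Implicit.
Unset Printing Implicit Defensive.

(** * Sizes of modal steps and their closure under cut *)

(* [shape a b c d]: a modal step with [a] unboxed and [b] boxed formulas on the
   left of its premise, [c] unboxed and [d] boxed ones on the right, is available.
   Up to weakening and contraction, [5] yields [N] (take [B := A]) and [D] yields
   [P], whence the disjunctions. *)
Definition shapeM (N P D F E : bool) (a b c d : nat) : bool :=
  match a, b, c, d with
  | 1, 0, 1, 0 => true
  | 0, 0, 1, 0 => N || E
  | 1, 0, 0, 0 => P || D
  | 2, 0, 0, 0 => D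
  | 0, 1, 1, 0 => F
  | 0, 0, 1, 1 => E
  | 1, 1, 0, 0 => D && F
  | 1, 0, 0, 1 => D && E
  | _, _, _, _ => false
  end.

Definition shapeC (N P D F E : bool) (a b c d : nat) : bool :=
  [&& c <= 1, (0 < b) ==> F, (0 < d) ==> E,
      (c == 1) ==> (0 < a + b) || N & (c == 0) ==> P || D].

Definition harmless (shape : nat -> nat -> nat -> nat -> bool) a b c d : bool :=
  (a == 0) && (c == 0) || shape a b c d.

(* [u], [v], [x], [y] count the copies of the cut formula in [U], [V], [X'], [Y'].
   [Z], [W] (resp. [Z'], [W']) are the boxed formulas that the first (resp. second)
   premise inherits when its boxed copies of the cut formula are cut away. *)
Definition cut_closed (shape : nat -> nat -> nat -> nat -> bool) : Prop :=
  forall a b c d a' b' c' d' u v x y,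
  shape a b c d -> shape a' b' c' d' ->
  u <= c -> v <= d -> x <= a' -> y <= b' -> 0 < u + v -> 0 < x + y ->
  let Z := if 0 < v then a' - x + (b' - y) else 0 in
  let W := if 0 < v then c' + d' else 0 in
  let Z' := if 0 < y then a + b else 0 in
  let W' := if 0 < y then c - u + (d - v) else 0 in
  if u == 0 then harmless shape a (b + Z) c (d - v + W)
  else if x == 0 then harmless shape a' (b' - y + Z') c' (d' + W')
  else harmless shape (a + (a' - x)) (b + Z + (b' - y + Z')) (c - u + c')
         (d - v + W + (d' + W')).

Lemma shapeM_cut_closed (N P D F E : bool) :
  (E -> D -> F) -> cut_closed (shapeM N P D F E).
Proof.
move=> EDF a b c d a' b' c' d' u v x y.
case: a => [|[|[|a]]]; case: b => [|[|b]]; case: c => [|[|c]];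
  case: d => [|[|d]] //=.
all: case: a' => [|[|[|a']]]; case: b' => [|[|b']]; case: c' => [|[|c']];
  case: d' => [|[|d']] //=.
all: move=> h h'.
all: case: u => [|[|u]] //; case: v => [|[|v]] // _ _;
  case: x => [|[|[|x]]] //;  case: y => [|[|y]] //= _ _ _ _.
all: move: EDF h h'; rewrite /harmless.
all: try by [].
all: case: D; case: E => //=; case: P => //=; case: F => //=.
all: by move=> H *; rewrite ?orbT; try exact: H.
Qed.

(** Sizes are unbounded here, so the check is arithmetical. [0 < v] forces [E] and hence [F], which
    admits [W] and [Z]; [0 < y] forces [F], which admits [Z']. If [0 < u], then [c = u = 1]: the
    outcome has [c'] unboxed formulas on the right, and [W'] is at most [d]. *)
Lemma shapeC_cut_closed (N P D F E : bool) :
  (E -> N) -> (E -> F) -> cut_closed (shapeC N P D F E).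
Proof.
move=> EN EF a b c d a' b' c' d' u v x y.
rewrite /harmless /shapeC; move: (P || D) => PD.
case/and5P=> c1 /implyP bF /implyP dE /implyP h1 /implyP h0.
case/and5P=> c1' /implyP bF' /implyP dE' /implyP h1' /implyP h0'.
move=> uc vd xa yb uv xy /=.
(* The case [i = k = 0] is harmless, so [PD] is asked for only when [0 < i]. *)
have ok i j k l : k <= 1 -> (0 < j -> F) -> (0 < l -> E) ->
    (k = 1 -> 0 < i + j \/ N) -> (k = 0 -> 0 < i -> PD) ->
    ((i == 0) && (k == 0)) || [&& k <= 1, (0 < j) ==> F, (0 < l) ==> E,
      (k == 1) ==> (0 < i + j) || N & (k == 0) ==> PD].
  move=> k1 /implyP -> /implyP -> g1 g0; rewrite k1.
  case: k k1 g1 g0 => [|[|//]] _ g1 g0 /=; last first.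
    by rewrite (introT orP (g1 _)) // orbT.
  by case: i g0 {g1} => //= i ->.
have {}h1 : c = 1 -> 0 < a + b \/ N by move=> /eqP /h1 /orP.
have {}h1' : c' = 1 -> 0 < a' + b' \/ N by move=> /eqP /h1' /orP.
have {}h0 : c = 0 -> PD by move=> /eqP /h0.
have {}h0' : c' = 0 -> PD by move=> /eqP /h0'.
case: (u =P 0) => u0; last case: (x =P 0) => x0; apply: ok.
all: case: (posnP v) => v0; case: (posnP y) => y0; move=> *; lia.
Qed.

(** * A set-based calculus with bounded height *)

(* Each premise is given by what it adds on the left and on the right. *)
Definition premL (F : form) : option (seq (seq form * seq form)) :=
  match F with
  | Bot => Some [::]
  | Neg A => Some [:: ([::], [:: A])]
  | And A B => Some [:: ([:: A; B], [::])]
  | Or A B => Some [:: ([:: A], [::]); ([:: B], [::])]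
  | Imp A B => Some [:: ([::], [:: A]); ([:: B], [::])]
  | _ => None
  end.

Definition premR (F : form) : option (seq (seq form * seq form)) :=
  match F with
  | Top => Some [::]
  | Neg A => Some [:: ([:: A], [::])]
  | And A B => Some [:: ([::], [:: A]); ([::], [:: B])]
  | Or A B => Some [:: ([::], [:: A; B])]
  | Imp A B => Some [:: ([:: A], [:: B])]
  | _ => None
  end.

(* Sequences stand for sets: only membership is tested, and principal formulas are
   kept in the premises.  The number bounds the height. *)
Inductive prov (shape : nat -> nat -> nat -> nat -> bool) :
    nat -> seq form -> seq form -> Prop :=
| prov_init n p G H : Var p \in G -> Var p \in H -> prov shape n G H
| prov_left n F ps G H :
    F \in G -> premL F = Some ps ->
    (forall q, q \in ps -> prov shape n (q.1 ++ G) (q.2 ++ H)) ->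
    prov shape n.+1 G H
| prov_right n F ps G H :
    F \in H -> premR F = Some ps ->
    (forall q, q \in ps -> prov shape n (q.1 ++ G) (q.2 ++ H)) ->
    prov shape n.+1 G H
| prov_modal n X Y U V G H :
    shape (size X) (size Y) (size U) (size V) ->
    prov shape n (X ++ map Box Y) (U ++ map Box V) ->
    {subset map Box X ++ map Box Y <= G} ->
    {subset map Box U ++ map Box V <= H} ->
    prov shape n.+1 G H.

Definition provable shape G H : Prop := exists n, prov shape n G H.

Lemma sub_cat2 (s t u : seq form) : {subset t <= u} -> {subset s ++ t <= s ++ u}.
Proof. by move=> tu z; rewrite !mem_cat => /orP[->|/tu ->]; rewrite ?orbT. Qed.

(** Each rule reads its conclusion only through membership, so weakening and contraction are
    absorbed at the same height. *)
Lemma prov_sub shape n G H G' H' :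
  prov shape n G H -> {subset G <= G'} -> {subset H <= H'} -> prov shape n G' H'.
Proof.
move=> d; elim: d G' H' => {n G H} [n p|n F ps|n F ps|n X Y U V] G H.
- by move=> pG pH G' H' sG sH; apply: (@prov_init _ _ p); [exact: sG|exact: sH].
- move=> FG eF _ IH G' H' sG sH; apply: (prov_left (sG _ FG) eF) => q qps.
  exact: IH q qps _ _ (sub_cat2 sG) (sub_cat2 sH).
- move=> FH eF _ IH G' H' sG sH; apply: (prov_right (sH _ FH) eF) => q qps.
  exact: IH q qps _ _ (sub_cat2 sG) (sub_cat2 sH).
- move=> ok d _ sX sU G' H' sG sH; apply: (prov_modal ok d) => z.
    by move/sX/sG.
  by move/sU/sH.
Qed.

Lemma prov_leq shape n m G H : n <= m -> prov shape n G H -> prov shape m G H.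
Proof.
move=> nm d; elim: d m nm => {n G H} [n p|n F ps|n F ps|n X Y U V] G H.
- by move=> pG pH m _; apply: (@prov_init _ _ p).
- move=> FG eF _ IH [//|m] nm; apply: (prov_left FG eF) => q qps; exact: IH.
- move=> FG eF _ IH [//|m] nm; apply: (prov_right FG eF) => q qps; exact: IH.
- by move=> ok _ IH sX sU [//|m] nm; apply: (prov_modal ok (IH _ nm)).
Qed.

Lemma provable_sub shape G H G' H' :
  provable shape G H -> {subset G <= G'} -> {subset H <= H'} ->
  provable shape G' H'.
Proof. by move=> [n d] sG sH; exists n; exact: prov_sub d sG sH. Qed.

(** Finitely many premises share a height bound, the maximum of their own bounds. *)
Lemma provable_premises shape (ps : seq (seq form * seq form)) G H :
  (forall q, q \in ps -> provable shape (q.1 ++ G) (q.2 ++ H)) ->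
  exists n, forall q, q \in ps -> prov shape n (q.1 ++ G) (q.2 ++ H).
Proof.
elim: ps => [|q ps IH] h; first by exists 0.
have [|n hn] := IH; first by move=> r rps; apply: h; rewrite inE rps orbT.
have [m hm] := h q (mem_head _ _).
exists (maxn n m) => r; rewrite inE => /orP[/eqP ->|/hn].
  exact: prov_leq (leq_maxr _ _) hm.
exact: prov_leq (leq_maxl _ _).
Qed.

Lemma provable_left shape F ps G H :
  F \in G -> premL F = Some ps ->
  (forall q, q \in ps -> provable shape (q.1 ++ G) (q.2 ++ H)) ->
  provable shape G H.
Proof.
by move=> FG eF /provable_premises[n hn]; exists n.+1; exact: prov_left FG eF hn.
Qed.

Lemma provable_right shape F ps G H :
  F \in H -> premR F = Some ps ->
  (forall q, q \in ps -> provable shape (q.1 ++ G) (q.2 ++ H)) ->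
  provable shape G H.
Proof.
by move=> FG eF /provable_premises[n hn]; exists n.+1; exact: prov_right FG eF hn.
Qed.

(* With no unboxed formula the premise of a modal step is its conclusion, so
   the step needs no rule. *)
Lemma provable_modal shape X Y U V G H :
  harmless shape (size X) (size Y) (size U) (size V) ->
  provable shape (X ++ map Box Y) (U ++ map Box V) ->
  {subset map Box X ++ map Box Y <= G} ->
  {subset map Box U ++ map Box V <= H} ->
  provable shape G H.
Proof.
case/orP=> [|ok [n d] sG sH]; last by exists n.+1; exact: prov_modal ok d sG sH.
by rewrite !size_eq0 => /andP[/eqP -> /eqP ->]; exact: provable_sub.
Qed.

(** * Admissibility of cut in the set-based calculus *)

Definition cut_adm shape (A : form) : Prop :=
  forall G H, provable shape G (A :: H) -> provable shape (A :: G) H ->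
  provable shape G H.

Definition immediate (A : form) : seq form :=
  match A with
  | Neg B | Box B => [:: B]
  | And B C | Or B C | Imp B C => [:: B; C]
  | _ => [::]
  end.

Lemma sub_rot1 (A : form) (s t : seq form) : {subset s ++ A :: t <= A :: s ++ t}.
Proof. by move=> z; rewrite !(inE, mem_cat) orbCA. Qed.

Lemma sub_wk (A : form) (s t : seq form) : {subset A :: t <= A :: s ++ t}.
Proof.
by move=> z; rewrite !(inE, mem_cat) => /orP[] ->; rewrite ?orbT.
Qed.

Lemma sub_catl (s t : seq form) : {subset t <= s ++ t}.
Proof. by move=> z zt; rewrite mem_cat zt orbT. Qed.

(** The cut formula is principal on both sides and already removed from all premises, so only cuts
    on its immediate subformulas remain, one per subformula. *)
Lemma cut_logical shape A ps qs G H :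
  (forall B, B \in immediate A -> cut_adm shape B) ->
  premR A = Some ps -> premL A = Some qs ->
  (forall q, q \in ps -> provable shape (q.1 ++ G) (q.2 ++ H)) ->
  (forall q, q \in qs -> provable shape (q.1 ++ G) (q.2 ++ H)) ->
  provable shape G H.
Proof.
case: A => //= [A|A B|A B|A B] cut [<-] [<-] hR hL.
- apply: (cut A); first by rewrite mem_head.
    exact: (hL _ (mem_head _ _)).
  exact: (hR _ (mem_head _ _)).
- have cA := hR _ (mem_head _ _).
  have cB : provable shape G (B :: H).
    by apply: (hR ([::], [:: B])); rewrite !inE eqxx orbT.
  have cAB := hL _ (mem_head _ _).
  apply: (cut A) => //; first by rewrite mem_head.
  apply: (cut B); first by rewrite !inE eqxx orbT.
    by apply: provable_sub cB _ _ => // z zG; rewrite inE zG orbT.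
  by apply: provable_sub cAB _ _ => // z; rewrite !inE orbCA.
- have cA := hL _ (mem_head _ _).
  have cB : provable shape (B :: G) H.
    by apply: (hL ([:: B], [::])); rewrite !inE eqxx orbT.
  have cAB := hR _ (mem_head _ _).
  apply: (cut A) => //; first by rewrite mem_head.
  apply: (cut B); first by rewrite !inE eqxx orbT.
    by apply: provable_sub cAB _ _ => // z; rewrite !inE orbCA.
  by apply: provable_sub cB _ _ => // z zG; rewrite inE zG orbT.
- have cA := hL _ (mem_head _ _).
  have cB : provable shape (B :: G) H.
    by apply: (hL ([:: B], [::])); rewrite !inE eqxx orbT.
  have cAB := hR _ (mem_head _ _).
  apply: (cut A) => //; first by rewrite mem_head.
  apply: (cut B); first by rewrite !inE eqxx orbT.
    exact: cAB.
  apply: provable_sub cB _ _ => // z; rewrite !inE => /orP[] ->;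
    by rewrite ?orbT.
Qed.

Lemma Box_inj : injective Box.
Proof. by move=> A B []. Qed.

Definition delete (C : form) (s : seq form) : seq form := [seq B <- s | B != C].

Lemma size_delete C s : size (delete C s) = size s - count_mem C s.
Proof. by rewrite size_filter -(count_predC (pred1 C) s) addKn. Qed.

Lemma mem_boxed_delete z C s :
  (z \in map Box (delete C s)) = (z != Box C) && (z \in map Box s).
Proof.
apply/mapP/andP => [[B]|[zC /mapP[B Bs ez]]].
  by rewrite mem_filter => /andP[BC Bs] ->; rewrite (inj_eq Box_inj) map_f.
by exists B => //; rewrite mem_filter Bs andbT -(inj_eq Box_inj) -ez.
Qed.

Lemma mem_delete z C s : (z \in delete C s) = (z != C) && (z \in s).
Proof. exact: mem_filter. Qed.

Lemma subset_implyb (s t : seq form) :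
  {subset s <= t} -> forall z, (z \in s) ==> (z \in t).
Proof. by move=> st z; apply/implyP/st. Qed.

(** At a fixed element, an inclusion is a Boolean formula in atomic memberships and equalities; it
    is decided by its truth table. *)
Ltac bool_cases :=
  repeat match goal with
  | |- context [in_mem ?z ?p] => case: (in_mem z p) => //=
  | |- context [?z == ?w :> form] => case: (z == w) => //=
  end.

Ltac memE := rewrite ?(map_cat, mem_cat, inE, mem_boxed_delete, mem_delete).

(** [IH] removes the boxed copies of [C] at a smaller height sum, [cutC] then removes the unboxed
    ones, and [closed] guarantees that the combined step is available or harmless. *)
Lemma cut_modal shape C n m X Y U V X' Y' U' V' G H :
  cut_closed shape -> cut_adm shape C ->
  (forall n' m' G H, n' + m' < n.+1 + m.+1 -> prov shape n' G (Box C :: H) ->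
     prov shape m' (Box C :: G) H -> provable shape G H) ->
  shape (size X) (size Y) (size U) (size V) ->
  prov shape n (X ++ map Box Y) (U ++ map Box V) ->
  {subset map Box X ++ map Box Y <= G} ->
  {subset map Box U ++ map Box V <= Box C :: H} ->
  shape (size X') (size Y') (size U') (size V') ->
  prov shape m (X' ++ map Box Y') (U' ++ map Box V') ->
  {subset map Box X' ++ map Box Y' <= Box C :: G} ->
  {subset map Box U' ++ map Box V' <= H} ->
  Box C \in map Box U ++ map Box V -> Box C \in map Box X' ++ map Box Y' ->
  provable shape G H.
Proof.
move=> closed cutC IH ok1 d1 sG1 sH1 ok2 d2 sG2 sH2.
rewrite !mem_cat !(mem_map Box_inj) => CUV CXY.
pose Z := if C \in V then delete C X' ++ delete C Y' else [::].
pose W := if C \in V then U' ++ V' else [::].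
pose Z' := if C \in Y' then X ++ Y else [::].
pose W' := if C \in Y' then delete C U ++ delete C V else [::].
(* If [C] occurs in [V], the first premise contains [Box C] and is cut against the conclusion of the
   second step. It inherits the rest of that conclusion, all of it boxed, as [Z] and [W]. *)
have P1 : provable shape (X ++ map Box (Y ++ Z))
                         (U ++ map Box (delete C V ++ W)).
  rewrite /Z /W; case: ifP => CV.
    apply: (IH n m.+1); first lia.
    - by apply: prov_sub d1 _ _ => z; memE; bool_cases.
    - by apply: prov_modal ok2 d2 _ _ => z; memE; bool_cases.
  exists n; apply: prov_sub d1 _ _ => z; memE; first by bool_cases.
  case/orP=> [->//|zV]; rewrite zV (contraFneq _ CV) ?orbT //= => zC.
  by move: zV; rewrite zC mem_map //; exact: Box_inj.
have P2 : provable shape (X' ++ map Box (delete C Y' ++ Z'))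
                         (U' ++ map Box (V' ++ W')).
  rewrite /Z' /W'; case: ifP => CY.
    apply: (IH n.+1 m); first lia.
    - by apply: prov_modal ok1 d1 _ _ => z; memE; bool_cases.
    - by apply: prov_sub d2 _ _ => z; memE; bool_cases.
  exists m; apply: prov_sub d2 _ _ => z; memE; last by bool_cases.
  case/orP=> [->//|zV]; rewrite zV (contraFneq _ CY) ?orbT //= => zC.
  by move: zV; rewrite zC mem_map //; exact: Box_inj.
have count_gt0 s : (0 < count_mem C s) = (C \in s).
  by rewrite -has_count has_pred1.
(* Closure is used at the numbers of copies of [C]; the rewriting below turns its arithmetic into
   sizes of the actual sequences. *)
have := closed _ _ _ _ _ _ _ _ (count_mem C U) (count_mem C V)
  (count_mem C X') (count_mem C Y') ok1 ok2 (count_size _ _) (count_size _ _)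
  (count_size _ _) (count_size _ _).
rewrite !addn_gt0 !count_gt0 => /(_ CUV CXY) /=.
have -> : (if C \in V then size X' - count_mem C X' + (size Y' - count_mem C Y')
           else 0) = size Z.
  by rewrite /Z; case: ifP => // _; rewrite size_cat !size_delete.
have -> : (if C \in V then size U' + size V' else 0) = size W.
  by rewrite /W; case: ifP => // _; rewrite size_cat.
have -> : (if C \in Y' then size X + size Y else 0) = size Z'.
  by rewrite /Z'; case: ifP => // _; rewrite size_cat.
have -> : (if C \in Y' then size U - count_mem C U + (size V - count_mem C V)
           else 0) = size W'.
  by rewrite /W'; case: ifP => // _; rewrite size_cat !size_delete.
rewrite !eqn0Ngt !count_gt0 -!size_delete -!size_cat.
have sZ z : (z \in map Box Z) ==>
    (z != Box C) && (z \in map Box X' ++ map Box Y').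
  by rewrite /Z; case: ifP => // _; memE; bool_cases.
have sW z : (z \in map Box W) ==> (z \in map Box U' ++ map Box V').
  by rewrite /W; case: ifP => // _; memE; bool_cases.
have sZ' z : (z \in map Box Z') ==> (z \in map Box X ++ map Box Y).
  by rewrite /Z'; case: ifP => // _; memE; bool_cases.
have sW' z : (z \in map Box W') ==>
    (z != Box C) && (z \in map Box U ++ map Box V).
  by rewrite /W'; case: ifP => // _; memE; bool_cases.
have CbG : Box C \in map Box X' -> C \in X' by rewrite mem_map //; exact: Box_inj.
have CbH : Box C \in map Box U -> C \in U by rewrite mem_map //; exact: Box_inj.
(* With [C] absent from [U], the cleaned first premise [P1] no longer involves [C] on the right, and
   a step from it alone suffices. *)
case: ifPn => [CU|_].
  move=> ok; apply: provable_modal ok P1 _ _ => z.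
    move: (subset_implyb sG1 z) (subset_implyb sG2 z) (sZ z).
    by memE; bool_cases.
  move: (subset_implyb sH1 z) (subset_implyb sH2 z) (sW z); memE.
  have : (z == Box C) ==> (z \notin map Box U).
    by apply/implyP => /eqP ->; apply: contraNN CU.
  bool_cases.
(* Dually, with [C] absent from [X'], the cleaned second premise [P2] suffices. *)
case: ifPn => [CX|_].
  move=> ok; apply: provable_modal ok P2 _ _ => z; last first.
    move: (subset_implyb sH1 z) (subset_implyb sH2 z) (sW' z).
    by memE; bool_cases.
  move: (subset_implyb sG1 z) (subset_implyb sG2 z) (sZ' z); memE.
  have : (z == Box C) ==> (z \notin map Box X').
    by apply/implyP => /eqP ->; apply: contraNN CX.
  bool_cases.
(* Both cleaned premises contain [C] unboxed: they are cut on [C] and one modal step follows. *)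
move=> ok; apply: provable_modal ok _ _ _; last first.
- move=> z; move: (subset_implyb sH1 z) (subset_implyb sH2 z) (sW z) (sW' z).
  by memE; bool_cases.
- move=> z; move: (subset_implyb sG1 z) (subset_implyb sG2 z) (sZ z) (sZ' z).
  by memE; bool_cases.
apply: cutC.
  by apply: provable_sub P1 _ _ => z; memE; bool_cases.
by apply: provable_sub P2 _ _ => z; memE; bool_cases.
Qed.

Lemma sub_behead (A : form) (s t : seq form) :
  {subset s <= A :: t} -> A \notin s -> {subset s <= t}.
Proof.
move=> st As z zs; move: (st z zs); rewrite inE => /orP[/eqP eA|//].
by rewrite -eA zs in As.
Qed.

(** Inner induction on the sum of the two heights. Non-principal cuts move into the premises;
    principal ones go to [cut_logical] or [cut_modal]. *)
Lemma cut_step shape A :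
  cut_closed shape -> (forall B, B \in immediate A -> cut_adm shape B) ->
  cut_adm shape A.
Proof.
move=> closed cut G H [n d1] [m d2].
have [k] := ubnP (n + m); elim: k => // k IH in n m G H d1 d2 *.
rewrite ltnS => nm.
have {k nm} IH n' m' G' H' : n' + m' < n + m -> prov shape n' G' (A :: H') ->
    prov shape m' (A :: G') H' -> provable shape G' H'.
  by move=> lt d1' d2'; apply: (IH n' m') => //; exact: leq_trans nm.
(* Analysis of the last rule on the right premise of the cut, in continuation form: the three
   hypotheses are the ways in which [A] can be principal there, and all other cases are settled at
   once. *)
have cases2 : (forall p, A = Var p -> Var p \in H -> provable shape G H) ->
    (forall m' qs, m = m'.+1 -> premL A = Some qs ->
       (forall q, q \in qs -> prov shape m' (q.1 ++ A :: G) (q.2 ++ H)) ->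
       provable shape G H) ->
    (forall m' X Y U V, m = m'.+1 -> A \in map Box X ++ map Box Y ->
       shape (size X) (size Y) (size U) (size V) ->
       prov shape m' (X ++ map Box Y) (U ++ map Box V) ->
       {subset map Box X ++ map Box Y <= A :: G} ->
       {subset map Box U ++ map Box V <= H} -> provable shape G H) ->
    provable shape G H.
  move eG1 : (A :: G) d2 IH => G1 d2 IH hinit hleft hmodal.
  case: d2 eG1 IH hinit hleft hmodal d1 =>
      {m G1 H} [m p|m F ps|m F ps|m X Y U V] G1 H.
  - move=> + pH eG1 _ hinit _ _ _; subst G1; rewrite inE => /orP[/eqP pA|pG].
      by apply: (hinit p).
    by exists 0; apply: (@prov_init _ _ p).
  - move=> + eF dps eG1 IH _ hleft _ d1; subst G1; rewrite inE.
    case/orP=> [/eqP FA|FG].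
      by rewrite FA in eF; exact: (hleft m ps).
    apply: (provable_left FG eF) => q qps; apply: (IH n m); first by rewrite addnS.
      apply: prov_sub d1 _ _; first exact: sub_catl.
      exact: sub_wk.
    by apply: prov_sub (dps q qps) _ _ => //; exact: sub_rot1.
  - move=> FH eF dps eG1 IH _ _ _ d1; subst G1.
    apply: (provable_right FH eF) => q qps; apply: (IH n m); first by rewrite addnS.
      apply: prov_sub d1 _ _; first exact: sub_catl.
      exact: sub_wk.
    by apply: prov_sub (dps q qps) _ _ => //; exact: sub_rot1.
  - move=> ok d sG sH eG1 IH _ _ hmodal _; subst G1.
    have [AXY|AXY] := boolP (A \in map Box X ++ map Box Y).
      exact: hmodal ok d _ _.
    by exists m.+1; apply: prov_modal ok d (sub_behead sG AXY) sH.
move eH1 : (A :: H) d1 IH cases2 => H1 d1.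
case: d1 eH1 d2 => {n G H1} [n p|n F ps|n F ps|n X Y U V] G H1.
- move=> pG + eH1 d2 _ _; rewrite -eH1 inE => /orP[/eqP pA|pH].
    (* Here [A] is a variable already in [G], so [d2] becomes the result by contraction. *)
    by exists m; apply: prov_sub d2 _ _ => // z; rewrite inE => /orP[/eqP ->|//];
      rewrite -pA.
  by exists 0; apply: (@prov_init _ _ p).
- move=> FG eF dps eH1 d2 IH _.
  apply: (provable_left FG eF) => q qps; apply: (IH n m); first by rewrite addSn.
    by apply: prov_sub (dps q qps) _ _ => //; rewrite -eH1; exact: sub_rot1.
  apply: prov_sub d2 _ _; last exact: sub_catl.
  exact: sub_wk.
- move=> + eF dps eH1 d2 IH cases2; rewrite -eH1 inE.
  (* Premises keep the principal formula, so [A] is first cut out of them against the whole of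
     [d2]. *)
  have dps' q : q \in ps -> provable shape (q.1 ++ G) (q.2 ++ H).
    move=> qps; apply: (IH n m); first by rewrite addSn.
      by apply: prov_sub (dps q qps) _ _ => //; rewrite -eH1; exact: sub_rot1.
    apply: prov_sub d2 _ _; last exact: sub_catl.
    exact: sub_wk.
  case/orP=> [/eqP FA|FH]; last exact: (provable_right FH eF).
  rewrite {F}FA in eF; apply: cases2 => [p eA|m' qs em eA dqs|].
  + by rewrite eA in eF.
  + apply: (cut_logical cut eF eA dps') => q qqs.
    apply: (IH n.+1 m'); first by rewrite em ltn_add2l.
      have AH1 : A \in H1 by rewrite -eH1 mem_head.
      apply: prov_sub (prov_right AH1 eF dps) _ _; first exact: sub_catl.
      by rewrite -eH1; exact: sub_wk.
    by apply: prov_sub (dqs q qqs) _ _ => //; exact: sub_rot1.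
  (* A formula principal in a propositional rule is not boxed. *)
  + move=> m' X Y U V _ + _ _ _ _.
    by rewrite -map_cat => /mapP[C _ eA]; rewrite eA in eF.
- move=> ok d sG sH eH1 d2 IH cases2; rewrite -eH1 in sH.
  have [AUV|AUV] := boolP (A \in map Box U ++ map Box V); last first.
    (* If the step does not introduce [A], its conclusion already lies within [G] and [H]. *)
    by exists n.+1; apply: prov_modal ok d sG (sub_behead sH AUV).
  have [C _ eA] : exists2 C, C \in U ++ V & A = Box C.
    by apply/mapP; rewrite map_cat.
  rewrite {}eA in AUV IH cut sH cases2 *.
  apply: cases2 => // m' X' Y' U' V' em AXY' ok' d' sG' sH'.
  apply: cut_modal closed (cut _ (mem_head _ _)) _ ok d sG sH ok' d' sG' sH' AUV AXY'.
  by rewrite -em.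
Qed.

Theorem cut_admissible shape A : cut_closed shape -> cut_adm shape A.
Proof.
move=> closed.
elim: A => [p|||A cA|A cA B cB|A cA B cB|A cA B cB|A cA];
  apply: (cut_step closed) => C //=; rewrite !inE.
1,5: by move/eqP ->.
all: by case/orP=> /eqP ->.
Qed.

Local Open Scope mset_scope.

(** * The logics concerned *)

Definition shape_of (Ax : {set axiom_name}) : nat -> nat -> nat -> nat -> bool :=
  (if axC \in Ax then shapeC else shapeM)
    (axN \in Ax) (axP \in Ax) (axD \in Ax) (ax4 \in Ax) (ax5 \in Ax).

(** [T] lacks the common modal form and is excluded; the conditions on [5] are the hypotheses of the
    two closure lemmas. *)
Definition admissible (Ax : {set axiom_name}) : bool :=
  (axT \notin Ax) &&
  ((ax5 \in Ax) ==>
     if axC \in Ax then (axN \in Ax) && (ax4 \in Ax)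
     else (axD \in Ax) ==> (ax4 \in Ax)).

Lemma shape_of_cut_closed Ax : admissible Ax -> cut_closed (shape_of Ax).
Proof.
rewrite /admissible /shape_of => /andP[_ /implyP h].
case: ifP h => [_ h|_ h]; [apply: shapeC_cut_closed|apply: shapeM_cut_closed].
- by move/h/andP=> [].
- by move/h/andP=> [].
- by move=> /h/implyP.
Qed.

(** * From the multiset calculus with multicut to the set-based one *)

Lemma mem_enum_msetD z (A B : {mset form}) :
  (z \in enum_mset (A `+` B)) = (z \in enum_mset A) || (z \in enum_mset B).
Proof. exact: in_msetD. Qed.

Lemma mem_enum_msetn z n (a : form) :
  (z \in enum_mset (msetn n a)) = (0 < n) && (z == a).
Proof. exact: in_msetn. Qed.

Lemma mem_enum_boxes z (A : {mset form}) :
  (z \in enum_mset (boxes A)) = (z \in map Box (enum_mset A)).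
Proof. exact: perm_mem (perm_eq_seq_mset _) z. Qed.

Lemma size_mset_gt0 (A : {mset form}) : (0 < size A) = (A != mset0).
Proof.
rewrite lt0n size_eq0; congr (~~ _); apply/eqP/eqP => [e|->]; last exact: enum_mset0.
by rewrite -(seq_mset_id A) e; apply/msetP => x; rewrite mset_seqE mset0E.
Qed.

Lemma size_msetD (A B : {mset form}) : size (A `+` B) = size A + size B.
Proof.
rewrite -size_cat; apply/perm_size/eq_seq_msetP; rewrite seq_mset_id.
by apply/msetP => x; rewrite mset_seqE count_cat !count_mem_mset msetE2.
Qed.

Ltac msetE := rewrite /= ?(mem_enum_msetD, mem_enum_msetn, mem_enum_boxes,
  enum_mset0, mem_cat, inE) /=.

Ltac subset_cases := by move=> z; msetE; bool_cases.

Ltac from_premise h := apply: provable_sub h _ _; subset_cases.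

Ltac shape_cases has adm :=
  move: has adm;
  rewrite /has_modal_rule /admissible /shape_of /shapeC /shapeM /=;
  repeat match goal with
  | |- context [@in_mem axiom_name ?a ?p] => case: (in_mem a p) => //=
  end; rewrite ?(implybT, orbT).

(** Rules are simulated one by one. Structural rules become inclusions of sets, and a multicut
    becomes one admissible cut because positive multiplicities are invisible to membership. *)
Lemma derivable_provable Ax S : admissible Ax ->
  derivable (calculus_CW_cut Ax) S -> provable (shape_of Ax) S.1 S.2.
Proof.
move=> adm; elim=> {S} ps c.
case=> [[[rule|rule]|rule]|rule] _ IH.
- have mem2 (p q : sequent) : q \in [:: p; q] by rewrite !inE eqxx orbT.
  case: rule IH => [p G H|G H|G H|A G H|A G H|A B G H|A B G H|A B G H
                   |A B G H|A B G H|A B G H] /= IH.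
  + by exists 0; apply: (@prov_init _ _ p); msetE; rewrite eqxx.
  + by apply: (@provable_left _ Bot [::]); msetE.
  + by apply: (@provable_right _ Top [::]); msetE.
  + have h := IH _ (mem_head _ _).
    apply: (@provable_left _ (Neg A) _ _ _ _ erefl); first by msetE; rewrite eqxx.
    by move=> q; rewrite inE => /eqP -> /=; from_premise h.
  + have h := IH _ (mem_head _ _).
    apply: (@provable_right _ (Neg A) _ _ _ _ erefl); first by msetE; rewrite eqxx.
    by move=> q; rewrite inE => /eqP -> /=; from_premise h.
  + have h := IH _ (mem_head _ _).
    apply: (@provable_left _ (And A B) _ _ _ _ erefl); first by msetE; rewrite eqxx.
    by move=> q; rewrite inE => /eqP -> /=; from_premise h.
  + have h := IH _ (mem_head _ _); have h' := IH _ (mem2 _ _).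
    apply: (@provable_right _ (And A B) _ _ _ _ erefl); first by msetE; rewrite eqxx.
    by move=> q; rewrite !inE => /orP[] /eqP -> /=; [from_premise h|from_premise h'].
  + have h := IH _ (mem_head _ _); have h' := IH _ (mem2 _ _).
    apply: (@provable_left _ (Or A B) _ _ _ _ erefl); first by msetE; rewrite eqxx.
    by move=> q; rewrite !inE => /orP[] /eqP -> /=; [from_premise h|from_premise h'].
  + have h := IH _ (mem_head _ _).
    apply: (@provable_right _ (Or A B) _ _ _ _ erefl); first by msetE; rewrite eqxx.
    by move=> q; rewrite inE => /eqP -> /=; from_premise h.
  + have h := IH _ (mem_head _ _); have h' := IH _ (mem2 _ _).
    apply: (@provable_left _ (Imp A B) _ _ _ _ erefl); first by msetE; rewrite eqxx.
    by move=> q; rewrite !inE => /orP[] /eqP -> /=; [from_premise h|from_premise h'].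
  + have h := IH _ (mem_head _ _).
    apply: (@provable_right _ (Imp A B) _ _ _ _ erefl); first by msetE; rewrite eqxx.
    by move=> q; rewrite inE => /eqP -> /=; from_premise h.
- case: rule IH => r {}ps {}c has rule IH.
  (* Each modal rule is placed in the common form by naming its unboxed ([X], [U]) and boxed ([Y],
     [V]) parts. *)
  have modal X Y U V : shape_of Ax (size X) (size Y) (size U) (size V) ->
      provable (shape_of Ax) (X ++ map Box Y) (U ++ map Box V) ->
      {subset map Box X ++ map Box Y <= enum_mset c.1} ->
      {subset map Box U ++ map Box V <= enum_mset c.2} ->
      provable (shape_of Ax) c.1 c.2.
    by move=> ok h sG sH; apply: provable_modal h sG sH; rewrite /harmless ok orbT.
  case: rule IH has modal => [A B|A|A|A B|A G H|A B|A B|A B|A B|G A nz|G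
    |G S B nz|G S|G S A|G S A D|G S D] IH has modal;
    have h := IH _ (mem_head _ _).
  + apply: (modal [:: A] [::] [:: B] [::]);
      [by shape_cases has adm|from_premise h|subset_cases|subset_cases].
  + apply: (modal [::] [::] [:: A] [::]);
      [by shape_cases has adm|from_premise h|subset_cases|subset_cases].
  + apply: (modal [:: A] [::] [::] [::]);
      [by shape_cases has adm|from_premise h|subset_cases|subset_cases].
  + apply: (modal [:: A; B] [::] [::] [::]);
      [by shape_cases has adm|from_premise h|subset_cases|subset_cases].
  + move: has adm; rewrite /has_modal_rule /admissible.
    by case: ifP => _ aT /andP[]; rewrite aT.
  + apply: (modal [::] [:: A] [:: B] [::]);
      [by shape_cases has adm|from_premise h|subset_cases|subset_cases].
  + apply: (modal [::] [::] [:: A] [:: B]);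
      [by shape_cases has adm|from_premise h|subset_cases|subset_cases].
  + apply: (modal [:: A] [:: B] [::] [::]);
      [by shape_cases has adm|from_premise h|subset_cases|subset_cases].
  + apply: (modal [:: A] [::] [::] [:: B]);
      [by shape_cases has adm|from_premise h|subset_cases|subset_cases].
  + apply: (modal (enum_mset G) [::] [:: A] [::]);
      [by rewrite -size_mset_gt0 in nz; shape_cases has adm; rewrite ?addn0 ?nz
      |from_premise h|subset_cases|subset_cases].
  + apply: (modal (enum_mset G) [::] [::] [::]);
      [by shape_cases has adm|from_premise h|subset_cases|subset_cases].
  + apply: (modal (enum_mset S) (enum_mset G) [:: B] [::]);
      [by rewrite -size_mset_gt0 size_msetD addnC in nz; shape_cases has adm; rewrite ?nz
      |from_premise h|subset_cases|subset_cases].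
  + apply: (modal (enum_mset S) (enum_mset G) [::] [::]);
      [by shape_cases has adm|from_premise h|subset_cases|subset_cases].
  + apply: (modal (enum_mset S) (enum_mset G) [:: A] [::]);
      [by shape_cases has adm|from_premise h|subset_cases|subset_cases].
  + apply: (modal (enum_mset S) (enum_mset G) [:: A] (enum_mset D));
      [by shape_cases has adm|from_premise h|subset_cases|subset_cases].
  + apply: (modal (enum_mset S) (enum_mset G) [::] (enum_mset D));
      [by shape_cases has adm|from_premise h|subset_cases|subset_cases].
- by case: rule IH => A G H IH; have h := IH _ (mem_head _ _); from_premise h.
- case: rule IH => A n m G H S P n0 m0 IH.
  have h := IH _ (mem_head _ _); have h' := IH _ (mem_last _ _).
  apply: (cut_admissible (A := A) (shape_of_cut_closed adm)).
    by apply: provable_sub h _ _ => z; msetE; rewrite ?n0; bool_cases.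
  by apply: provable_sub h' _ _ => z; msetE; rewrite ?m0; bool_cases.
Qed.

(** * From the set-based calculus back to multisets *)

Lemma seq_mset_cons (A : form) s : seq_mset (A :: s) = A +` seq_mset s.
Proof. by apply/msetP => x; rewrite msetE2 msetnE !mset_seqE /= eq_sym; case: eqP. Qed.

Lemma seq_mset_cat (s t : seq form) :
  seq_mset (s ++ t) = seq_mset s `+` seq_mset t.
Proof. by apply/msetP => x; rewrite msetE2 !mset_seqE count_cat. Qed.

Lemma seq_mset_nil : seq_mset [::] = mset0 :> {mset form}.
Proof. by apply/msetP => x; rewrite mset_seqE mset0E. Qed.

Lemma seq_mset_map_Box s : seq_mset (map Box s) = boxes (seq_mset s).
Proof. by apply/eq_seq_msetP; rewrite perm_sym; exact/perm_map/perm_eq_seq_mset. Qed.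

Lemma derivable1 (R : rules) p c : R [:: p] c -> derivable R p -> derivable R c.
Proof. by move=> Rc dp; apply: derivable_rule Rc _ => q; rewrite inE => /eqP ->. Qed.

Lemma derivable2 (R : rules) p q c :
  R [:: p; q] c -> derivable R p -> derivable R q -> derivable R c.
Proof.
by move=> Rc dp dq; apply: derivable_rule Rc _ => r; rewrite !inE => /orP[]/eqP ->.
Qed.

(** Weakening by all of [t] gives [s ++ t]; each formula of [s] is then contracted into its copy in
    [t]. *)
Lemma derivable_subL Ax s t (D : {mset form}) : {subset s <= t} ->
  derivable (calculus_CW Ax) (seq_mset s ⇒ D) ->
  derivable (calculus_CW Ax) (seq_mset t ⇒ D).
Proof.
move=> st d.
have {d} : derivable (calculus_CW Ax) (seq_mset (s ++ t) ⇒ D).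
  rewrite seq_mset_cat msetDC -seq_mset_cat.
  elim: t {st} => //= A t IH; rewrite seq_mset_cons.
  by apply: derivable1 IH; right; constructor.
elim: s st => // A s IH st; rewrite /= => d; apply: IH.
  by move=> z zs; apply: st; rewrite inE zs orbT.
have /perm_to_rem pA : A \in s ++ t by rewrite mem_cat st ?mem_head ?orbT.
have e : seq_mset (s ++ t) = A +` seq_mset (rem A (s ++ t)).
  by rewrite -seq_mset_cons; apply/eq_seq_msetP.
by rewrite seq_mset_cons e in d; rewrite e; apply: derivable1 d; right; constructor.
Qed.

Lemma derivable_subR Ax s t (G : {mset form}) : {subset s <= t} ->
  derivable (calculus_CW Ax) (G ⇒ seq_mset s) ->
  derivable (calculus_CW Ax) (G ⇒ seq_mset t).
Proof.
move=> st d.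
have {d} : derivable (calculus_CW Ax) (G ⇒ seq_mset (s ++ t)).
  rewrite seq_mset_cat msetDC -seq_mset_cat.
  elim: t {st} => //= A t IH; rewrite seq_mset_cons.
  by apply: derivable1 IH; right; constructor.
elim: s st => // A s IH st; rewrite /= => d; apply: IH.
  by move=> z zs; apply: st; rewrite inE zs orbT.
have /perm_to_rem pA : A \in s ++ t by rewrite mem_cat st ?mem_head ?orbT.
have e : seq_mset (s ++ t) = A +` seq_mset (rem A (s ++ t)).
  by rewrite -seq_mset_cons; apply/eq_seq_msetP.
by rewrite seq_mset_cons e in d; rewrite e; apply: derivable1 d; right; constructor.
Qed.

Lemma derivable_modal1 Ax r p c :
  has_modal_rule Ax r -> modal_rule r [:: p] c ->
  derivable (calculus_CW Ax) p -> derivable (calculus_CW Ax) c.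
Proof.
by move=> hr rule; apply: derivable1; left; right; apply: modal_rules_of hr rule.
Qed.

Lemma derivable_shapeM (Ax : {set axiom_name}) X Y U V :
  axC \notin Ax -> shape_of Ax (size X) (size Y) (size U) (size V) ->
  derivable (calculus_CW Ax) (seq_mset (X ++ map Box Y) ⇒ seq_mset (U ++ map Box V)) ->
  derivable (calculus_CW Ax)
    (seq_mset (map Box X ++ map Box Y) ⇒ seq_mset (map Box U ++ map Box V)).
Proof.
move=> nC; rewrite /shape_of (negbTE nC).
have has r : has_modal_rule Ax r = match r with
    | rM => true | rN => axN \in Ax | rP => axP \in Ax | rD => axD \in Ax
    | rT => axT \in Ax | r4 => ax4 \in Ax | r5 => ax5 \in Ax
    | rD4 => (axD \in Ax) && (ax4 \in Ax) | rD5 => (axD \in Ax) && (ax5 \in Ax)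
    | _ => false end by rewrite /has_modal_rule (negbTE nC).
case: X => [|A [|A' [|? ?]]]; case: Y => [|B [|? ?]];
  case: U => [|E [|? ?]]; case: V => [|F [|? ?]] //=;
  rewrite !(seq_mset_cons, seq_mset_nil, msetD0) => ok d.
- case/orP: ok => ok.
    by apply: derivable_modal1 (mN E) d; rewrite has.
  (* [5] in place of [N] *)
  apply: derivable1 (_ : derivable _ (mset0 ⇒ Box E +` [mset Box E])); last first.
    apply: derivable_modal1 (m5 E E) _; first by rewrite has.
    by rewrite msetDC; apply: derivable1 d; right; constructor.
  (* The empty context is made explicit so that the contraction rule matches. *)
  by right; rewrite -{2}[[mset Box E]]msetD0 -[X in (_ ⇒ X)]msetD0; constructor.
- by apply: derivable_modal1 (m5 E F) d; rewrite has.
- by apply: derivable_modal1 (m4 B E) d; rewrite has.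
- have [hP|nP] := boolP (axP \in Ax).
    by apply: derivable_modal1 (mP A) d; rewrite has.
  (* [D] in place of [P] *)
  apply: derivable1 (_ : derivable _ (Box A +` [mset Box A] ⇒ mset0)); last first.
    apply: derivable_modal1 (mD A A) _.
      by rewrite has; move: ok; rewrite (negbTE nP).
    by apply: derivable1 d; right; constructor.
  by right; rewrite -{2}[[mset Box A]]msetD0 -[X in (X ⇒ _)]msetD0; constructor.
- by apply: derivable_modal1 (mD5 A F) d; rewrite has.
- by apply: derivable_modal1 (mM A E) d; rewrite has.
- by apply: derivable_modal1 (mD4 A B) d; rewrite has.
- by apply: derivable_modal1 (mD A A') d; rewrite has.
Qed.

Lemma derivable_shapeC (Ax : {set axiom_name}) X Y U V :
  admissible Ax -> axC \in Ax ->
  shape_of Ax (size X) (size Y) (size U) (size V) ->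
  derivable (calculus_CW Ax) (seq_mset (X ++ map Box Y) ⇒ seq_mset (U ++ map Box V)) ->
  derivable (calculus_CW Ax)
    (seq_mset (map Box X ++ map Box Y) ⇒ seq_mset (map Box U ++ map Box V)).
Proof.
move=> /andP[_ adm] hC; rewrite /shape_of hC => ok d.
(* Which parts are empty determines the rule: a nonempty [Y] forces [4], and a nonempty [V] forces
   [5], hence [N] and [4] by admissibility. *)
have has : has_modal_rule Ax (
    if U is [::] then if V is [::] then if Y is [::] then rCD else rCD4 else rKD45
    else if V is [::] then
           if Y is [::] then if X is [::] then rN else rC else rC4
         else rK45).
  move: adm ok; rewrite /has_modal_rule /shapeC hC.
  move: (axN \in _) (axP \in _) (axD \in _) (ax4 \in _) (ax5 \in _).
  case: U {d} => [|? [|//]]; case: V => [|? ?]; case: Y => [|? ?]; case: X => [|? ?] //=;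
    by do 5 case.
have boxes0 : boxes mset0 = mset0.
  by rewrite -seq_mset_nil -seq_mset_map_Box.
have boxes1 A : boxes [mset A] = [mset Box A].
  by rewrite -(msetD0 [mset A]) -seq_mset_nil -seq_mset_cons -seq_mset_map_Box
    /= seq_mset_cons seq_mset_nil msetD0.
have neq0 (A : form) s : seq_mset (A :: s) != mset0.
  by rewrite -size_mset_gt0 (perm_size (perm_eq_seq_mset _)).
rewrite !seq_mset_cat !seq_mset_map_Box [boxes _ `+` _]msetDC in d *.
rewrite [seq_mset X `+` _]msetDC in d.
case: U ok has d => [|A [|? ?]]; last by rewrite /shapeC.
  rewrite seq_mset_nil boxes0 !mset0D.
  case: V => [|F V] _ has; last by apply: derivable_modal1 has _; constructor.
  rewrite seq_mset_nil boxes0.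
  case: Y has => [|B Y] has; last by apply: derivable_modal1 has _; constructor.
  by rewrite seq_mset_nil boxes0 !mset0D; apply: derivable_modal1 has _; constructor.
rewrite seq_mset_cons seq_mset_nil msetD0 boxes1.
case: V => [|F V] _ has; last by apply: derivable_modal1 has _; constructor.
rewrite seq_mset_nil boxes0 !msetD0.
case: Y has => [|B Y] has; last first.
  apply: derivable_modal1 has _; constructor.
  by rewrite -seq_mset_cat; apply: neq0.
rewrite seq_mset_nil boxes0 !mset0D.
case: X has => [|B X] has; last by apply: derivable_modal1 has _; constructor.
by rewrite seq_mset_nil boxes0; apply: derivable_modal1 has _; constructor.
Qed.

Lemma calculus_CW_G Ax ps c : G_rules ps c -> calculus_CW Ax ps c.
Proof. by move=> rule; left; left. Qed.

(** A propositional rule of [G] adds a second copy of the retained principal formula, which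
    contraction merges. A modal rule yields exactly its own formulas, and inclusion supplies the
    context. *)
Lemma provable_derivable Ax n G H : admissible Ax ->
  prov (shape_of Ax) n G H -> derivable (calculus_CW Ax) (seq_mset G ⇒ seq_mset H).
Proof.
move=> adm; elim=> {n G H} [n p|n F ps|n F ps|n X Y U V] G H.
- move=> pG pH.
  have sub (s : seq form) : Var p \in s -> {subset Var p :: s <= s}.
    by move=> ps z; rewrite inE => /orP[/eqP ->|].
  apply: derivable_subL (sub G pG) _; apply: derivable_subR (sub H pH) _.
  rewrite !seq_mset_cons.
  by apply: derivable_rule (calculus_CW_G Ax (G_init p _ _)) _.
- move=> FG eF _ IH.
  have sub : {subset F :: G <= G} by move=> z; rewrite inE => /orP[/eqP ->|].
  apply: derivable_subL sub _; rewrite seq_mset_cons.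
  have mem2 (p q : seq form * seq form) : q \in [:: p; q] by rewrite !inE eqxx orbT.
  case: F eF IH {FG} => //= [|A|A B|A B|A B] [<-] IH;
    try (have := IH _ (mem_head _ _)); try (have := IH _ (mem2 _ _));
    rewrite /= ?seq_mset_cons.
  + by apply: derivable_rule (calculus_CW_G Ax (G_botL _ _)) _.
  + by apply: derivable1 (calculus_CW_G Ax (G_negL _ _ _)).
  + by apply: derivable1 (calculus_CW_G Ax (G_andL _ _ _ _)).
  + by move=> dB dA; apply: derivable2 (calculus_CW_G Ax (G_orL _ _ _ _)) dA dB.
  + by move=> dB dA; apply: derivable2 (calculus_CW_G Ax (G_impL _ _ _ _)) dA dB.
- move=> FH eF _ IH.
  have sub : {subset F :: H <= H} by move=> z; rewrite inE => /orP[/eqP ->|].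
  apply: derivable_subR sub _; rewrite seq_mset_cons.
  have mem2 (p q : seq form * seq form) : q \in [:: p; q] by rewrite !inE eqxx orbT.
  case: F eF IH {FH} => //= [|A|A B|A B|A B] [<-] IH;
    try (have := IH _ (mem_head _ _)); try (have := IH _ (mem2 _ _));
    rewrite /= ?seq_mset_cons.
  + by apply: derivable_rule (calculus_CW_G Ax (G_topR _ _)) _.
  + by apply: derivable1 (calculus_CW_G Ax (G_negR _ _ _)).
  + by move=> dB dA; apply: derivable2 (calculus_CW_G Ax (G_andR _ _ _ _)) dA dB.
  + by apply: derivable1 (calculus_CW_G Ax (G_orR _ _ _ _)).
  + by apply: derivable1 (calculus_CW_G Ax (G_impR _ _ _ _)).
- move=> ok _ d sG sH; apply: derivable_subL sG _; apply: derivable_subR sH _.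
  have [hC|nC] := boolP (axC \in Ax); first exact: derivable_shapeC.
  exact: derivable_shapeM.
Qed.

(** * Multicut elimination for the listed logics *)

Lemma admissible_ax (Ax : {set axiom_name}) :
  Ax \subset [set axN; axC; axP; axD; ax4] \/
  Ax \in [:: ax_M5; ax_MP5; ax_M45; ax_MP45; ax_MD45; ax_K45; ax_KD45] ->
  admissible Ax.
Proof.
case=> [/subsetP sub|].
  have nin a : a \notin [set axN; axC; axP; axD; ax4] -> a \notin Ax.
    exact/contraNN/sub.
  by rewrite /admissible (negbTE (nin ax5 _)) ?nin // !inE.
rewrite !inE /admissible; do ?case/orP; move/eqP->; rewrite !inE //.
Qed.

Theorem mainTheorem15 (Ax : {set axiom_name})
  (hAx : Ax \subset [set axN; axC; axP; axD; ax4] \/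
         Ax \in [:: ax_M5; ax_MP5; ax_M45; ax_MP45; ax_MD45; ax_K45; ax_KD45])
  (S : sequent) :
  derivable (calculus_CW_cut Ax) S -> derivable (calculus_CW Ax) S.
Proof.
have adm := admissible_ax hAx.
move=> /(derivable_provable adm)[n /(provable_derivable adm)].
by case: S => G H; rewrite !seq_mset_id.
Qed.
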